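(* Let $H$ be a real Hilbert space, let $A$ generate a linear $C_0$-semigroup of isometries $S_0(t)$ on $H$, and let $B:H\to H$ be a bounded linear positive operator, i.e. $\langle Bz,z\rangle\ge 0$ for all $z\in H$. If the system $$\frac{dz(t)}{dt}=Az(t)+v(t)Bz(t),\qquad z(0)=z_0,$$ is exponentially stabilizable with a constant control, then there exist $T,\delta>0$ such that $$\int_0^T\langle BS_0(t)y,S_0(t)y\rangle\,dt\ \ge\ \delta\|y\|^2,\qquad \forall y\in H.$$
   Context: $H$ is a real Hilbert space with inner product $\langle\cdot,\cdot\rangle$ and norm $\|\cdot\|$. The system is exponentially stabilizable with a constant control if there exists a constant $c\in\mathbb{R}$ such that, with $v(t)\equiv c$, for each $z_0\in H$ there is a unique mild solution $z(t)$ defined for all $t\ge0$ (i.e. a continuous $z:[0,\infty)\to H$ with $z(t)=S_0(t)z_0+c\int_0^tS_0(t-s)Bz(s)\,ds$), and there exist $M,\sigma>0$ (possibly depending on $z_0$) such that $\|z(t)\|\le Me^{-\sigma t}\|z_0\|$ for all $t\ge 0$.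
   Formalization: B is also assumed self-adjoint: with only ⟨Bz,z⟩ ≥ 0 the claim fails, e.g. H = R², A = 0, B(x,y) = (2x+y, −x): the constant control −1 stabilizes exponentially, yet ⟨By,y⟩ = 0 for y = (0,1). *)

(* Defs.v *)
(* Stdlib reals and Coquelicot. *)
From Stdlib Require Import Reals.
From Coquelicot Require Import Coquelicot.
Set Implicit Arguments.
Unset Strict Implicit.
Unset Printing Implicit Defensive.
Open Scope R_scope.

(* [inner_norm] forces Coquelicot's norm, hence its complete uniform
   structure, to be the one induced by the inner product. *)
Record RealHilbert : Type := MkRealHilbert {
  hcarrier :> CompleteNormedModule R_AbsRing;
  inner : hcarrier -> hcarrier -> R;
  inner_sym : forall x y : hcarrier, inner x y = inner y x;
  inner_plus_l : forall x y z : hcarrier,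
    inner (plus x y) z = inner x z + inner y z;
  inner_scal_l : forall (a : R) (x y : hcarrier),
    inner (scal a x) y = a * inner x y;
  inner_pos : forall x : hcarrier, 0 <= inner x x;
  inner_def : forall x : hcarrier, inner x x = 0 -> x = zero;
  inner_norm : forall x : hcarrier, norm x = sqrt (inner x x)
}.

Arguments inner {r} _ _.

(* In all that follows functions of time are total on R, but only their values
   at t >= 0 matter. *)

(* Coquelicot's [is_linear] means linear and bounded. *)
Record C0_semigroup (H : RealHilbert) (S : R -> H -> H) : Prop := {
  C0_linear : forall t : R, 0 <= t -> is_linear (S t);
  C0_zero : forall x : H, S 0 x = x;
  C0_add : forall (s t : R) (x : H), 0 <= s -> 0 <= t ->
    S (s + t) x = S s (S t x);
  C0_cont : forall x : H, filterlim (fun t => S t x) (at_right 0) (locally x)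
}.

Definition isometric_family (H : RealHilbert) (S : R -> H -> H) : Prop :=
  forall (t : R) (x : H), 0 <= t -> norm (S t x) = norm x.

Definition generator_lim (H : RealHilbert) (S : R -> H -> H) (x y : H) : Prop :=
  filterlim (fun h : R => scal (/ h) (minus (S h x) x)) (at_right 0) (locally y).

(* The unbounded operator is the pair of its domain [D] and of [A]; the values
   of [A] outside [D] are irrelevant. *)
Definition generates (H : RealHilbert) (D : H -> Prop) (A : H -> H)
    (S : R -> H -> H) : Prop :=
  (forall x : H, D x <-> exists y : H, generator_lim S x y) /\
  (forall x : H, D x -> generator_lim S x (A x)).

(* "Positive" is meant in the usual operator-theoretic sense: self-adjoint with
   a nonnegative quadratic form. On a real space the sign condition does not
   imply self-adjointness, and it would not suffice here: for H = R^2,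
   S t = id, B (x, y) = (2 x + y, - x) one has <B z, z> = 2 x^2, and z' = - B z
   is exponentially stable (- B has the double eigenvalue -1), although
   <B (S t z), S t z> = 0 for every t when z = (0, 1). *)
Definition positive_operator (H : RealHilbert) (B : H -> H) : Prop :=
  (forall x y : H, inner (B x) y = inner x (B y)) /\
  (forall z : H, 0 <= inner (B z) z).

Definition mild_solution (H : RealHilbert) (S : R -> H -> H) (B : H -> H)
    (c : R) (z0 : H) (z : R -> H) : Prop :=
  (forall t : R, 0 <= t ->
     filterlim z (within (fun s => 0 <= s) (locally t)) (locally (z t))) /\
  (forall t : R, 0 <= t ->
     exists I : H, is_RInt (fun s => S (t - s) (B (z s))) 0 t I /\
                   z t = plus (S t z0) (scal c I)).

Definition exp_stabilizable_const (H : RealHilbert) (S : R -> H -> H)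
    (B : H -> H) : Prop :=
  exists c : R, forall z0 : H, exists z : R -> H,
    mild_solution S B c z0 z /\
    (forall z' : R -> H, mild_solution S B c z0 z' ->
       forall t : R, 0 <= t -> z' t = z t) /\
    (exists M sigma : R, 0 < M /\ 0 < sigma /\
       forall t : R, 0 <= t -> norm (z t) <= M * exp (- sigma * t) * norm z0).

(* Main.v *)
(* If c >= 0, the norm of a closed-loop solution is nondecreasing, so exponential
   decay forces H = 0. If c = - k < 0, the closed-loop flow is contractive, and
   the uniform boundedness principle turns the decay of each orbit into
   |z(T)| <= |y| / 2 for one T and all y. The deviation e = z - S0 y satisfies
   d|e|^2/dt = - 2 k <e, B e> - 2 k <e, B S0 y> <= (k / 2) <B S0 y, S0 y>, and
   |e(T)| >= |S0(T) y| - |z(T)| >= |y| / 2 since S0 is isometric, hence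
   |y|^2 / 4 <= (k / 2) int_0^T <B S0 y, S0 y>. *)
Require Import Defs.
From Stdlib Require Import Reals Lra Classical ClassicalEpsilon.
From Coquelicot Require Import Coquelicot.
Open Scope R_scope.

(** A mild solution need not be differentiable, so the energy balance cannot be read off the
    differential equation. It comes from the Duhamel formula: let f be the forcing and J the
    integral of S0(b - s) f(s) over [a, b]. Since S0 is isometric, |u(a)| = |S0(b - a) u(a)| = |u(b)
    - J|, whence |u(b)|^2 - |u(a)|^2 = 2 <u(b), J> - |J|^2, which near t is 2 (b - a) <u(t), f(t)>
    to first order. Keeping f arbitrary serves both the closed loop, where f = c B z, and the
    deviation e, whose forcing is again c B z because S0 y has none.

    The uniform boundedness principle needs linear operators, and linearity of y -> z(T) also comes
    from the energy: two closed-loop solutions with the same start differ by one that starts at 0,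
    and contractivity keeps it there. Applied to z(T) the principle would give a bound but no decay;
    a growing weight, which the exponential absorbs for each y, makes it give decay. *)

(** * Bounded linear maps and the uniform boundedness principle *)

Lemma minus_plus_l {G : AbelianGroup} (x y : G) : minus (plus x y) x = y.
Proof.
  change (plus (plus x y) (opp x) = y).
  rewrite (plus_comm x y), <- plus_assoc, plus_opp_r.
  apply plus_zero_r.
Qed.

Lemma plus_minus_r {G : AbelianGroup} (x y : G) : plus y (minus x y) = x.
Proof.
  rewrite plus_comm. change (plus (plus x (opp y)) y = x).
  rewrite <- plus_assoc. etransitivity; [| apply plus_zero_r].
  f_equal. exact (plus_opp_l y).
Qed.

(** Riemann sums commute with a linear map, and its continuity carries this to the limit. *)
Lemma is_RInt_linear {U V : NormedModule R_AbsRing} (l : U -> V) (f : R -> U)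
    (a b : R) (I : U) :
  is_linear l -> is_RInt f a b I -> is_RInt (fun t => l (f t)) a b (l I).
Proof.
  intros Hl Hf.
  apply filterlim_ext with
    (fun ptd => l (scal (sign (b - a)) (Riemann_sum f ptd))).
  - intros ptd. rewrite (linear_scal l Hl). f_equal.
    induction ptd as [x0 | h s IH] using SF_cons_ind.
    + exact (linear_zero l Hl).
    + rewrite !Riemann_sum_cons, (linear_plus l Hl), (linear_scal l Hl), IH.
      reflexivity.
  - eapply filterlim_comp; [exact Hf | apply (linear_cont l I Hl)].
Qed.

Lemma norm_scal_le {V : NormedModule R_AbsRing} (a : R) (x : V) :
  norm (scal a x) <= Rabs a * norm x.
Proof. exact (@norm_scal R_AbsRing V a x). Qed.

Lemma linear_lower_bound_nearby {V W : NormedModule R_AbsRing} (l : V -> W)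
    (x : V) (K : R) :
  is_linear l -> K < norm (l x) ->
  exists r : R, 0 < r /\
    forall y : V, norm (minus y x) <= r -> K < norm (l y).
Proof.
  intros Hl HK.
  destruct (linear_norm l Hl) as [M [HM Hb]].
  (* On a ball of this radius [l] moves by at most half of the gap between [norm (l x)] and [K]. *)
  exists ((norm (l x) - K) / (2 * M)). split.
  - apply Rdiv_lt_0_compat; lra.
  - intros y Hy.
    assert (H1 : norm (l (minus y x)) <= (norm (l x) - K) / 2).
    { eapply Rle_trans; [apply Hb |].
      replace ((norm (l x) - K) / 2) with (M * ((norm (l x) - K) / (2 * M)))
        by (field; lra).
      apply Rmult_le_compat_l; lra. }
    rewrite (linear_minus l y x Hl) in H1.
    pose proof (norm_triangle_inv (l y) (l x)) as H2.
    apply Rabs_le_between in H2. lra.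
Qed.

Lemma linear_bound_of_ball {V W : NormedModule R_AbsRing} (l : V -> W) (r C : R) :
  is_linear l -> 0 < r ->
  (forall x : V, norm x <= r -> norm (l x) <= C) ->
  forall x : V, norm (l x) <= C / r * norm x.
Proof.
  intros Hl Hr HC x.
  destruct (Req_dec (norm x) 0) as [Hx | Hx].
  - destruct (linear_norm l Hl) as [M [HM Hb]].
    specialize (Hb x). rewrite Hx in *. lra.
  - pose proof (norm_ge_0 x) as Hp.
    assert (Ha : 0 < r / norm x) by (apply Rdiv_lt_0_compat; lra).
    assert (H1 : norm (l (scal (r / norm x) x)) <= C).
    { apply HC. eapply Rle_trans; [apply norm_scal_le |].
      rewrite Rabs_pos_eq by lra. right. field. lra. }
    rewrite (linear_scal l Hl) in H1.
    replace (l x) with (scal (norm x / r) (scal (r / norm x) (l x))).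
    2:{ rewrite scal_assoc. unfold mult; simpl.
        replace (norm x / r * (r / norm x)) with 1 by (field; lra).
        apply (scal_one (l x)). }
    assert (Hb : 0 < norm x / r) by (apply Rdiv_lt_0_compat; lra).
    eapply Rle_trans; [apply norm_scal_le |].
    rewrite Rabs_pos_eq by lra.
    replace (C / r * norm x) with (norm x / r * C) by (field; lra).
    apply Rmult_le_compat_l; [lra | exact H1].
Qed.

(** If every [L n] stayed below [K] on the ball around [x], then writing xi = (x + xi) - x would
    bound all of them by 2 K on the ball of radius [r] around 0, hence uniformly by 2 K / r. *)
Lemma large_value_in_ball {V W : NormedModule R_AbsRing} (L : nat -> V -> W)
    (K r : R) (x : V) :
  (forall n, is_linear (L n)) ->
  ~ (exists C, forall n x, norm (L n x) <= C * norm x) -> 0 < r ->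
  exists n x', norm (minus x' x) <= r /\ K < norm (L n x').
Proof.
  intros HL Hno Hr. apply NNPP. intros Hk. apply Hno.
  exists ((K + K) / r). intros n.
  apply linear_bound_of_ball; [apply HL | assumption |].
  assert (Hk' : forall x', norm (minus x' x) <= r -> norm (L n x') <= K).
  { intros x' H'. apply Rnot_lt_le. intros H2. apply Hk.
    exists n, x'. split; assumption. }
  intros xi Hxi.
  rewrite <- (minus_plus_l x xi), (linear_minus _ _ _ (HL n)).
  eapply Rle_trans; [apply (@norm_triangle R_AbsRing W) |].
  rewrite (@norm_opp R_AbsRing W).
  apply Rplus_le_compat; apply Hk'.
  - rewrite minus_plus_l. assumption.
  - rewrite minus_eq_zero.
    eapply Rle_trans; [right; apply (@norm_zero R_AbsRing V) |]. lra.
Qed.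

(* Nested closed balls on the k-th of which some [L n] exceeds k everywhere. *)
Lemma uniform_boundedness {V : CompleteNormedModule R_AbsRing}
    {W : NormedModule R_AbsRing} (L : nat -> V -> W) :
  (forall n, is_linear (L n)) ->
  (forall x, exists M, forall n, norm (L n x) <= M) ->
  exists C, forall n x, norm (L n x) <= C * norm x.
Proof.
  intros HL Hpt. apply NNPP. intros Hno.
  assert (Htri : forall x y z : V,
      norm (minus x z) <= norm (minus x y) + norm (minus y z)).
  { intros x y z. rewrite (minus_trans y x z). apply (@norm_triangle _ V). }
  assert (Hsym : forall x y : V, norm (minus x y) = norm (minus y x)).
  { intros x y. rewrite <- (@norm_opp _ V), opp_minus. reflexivity. }
  assert (Hminus0 : forall x : V, norm (minus x x) = 0).
  { intros x. rewrite minus_eq_zero. apply (@norm_zero _ V). }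
  (* A pair is a centre and a radius. Positivity of the radius is a premise below the existential,
     so that choice yields a total [next]. Bounding the displacement and the new radius by half of
     the old radius keeps the new ball inside the old one. *)
  assert (Hstep : forall (k : nat) (p : V * R), exists q : V * R, 0 < snd p ->
      0 < snd q /\ snd q <= snd p / 2 /\
      norm (minus (fst q) (fst p)) <= snd p / 2 /\
      exists n, forall y, norm (minus y (fst q)) <= snd q -> INR k < norm (L n y)).
  { intros k [x r]; simpl.
    destruct (Rlt_dec 0 r) as [Hr | Hr]; [| exists (x, r); intros; lra].
    destruct (large_value_in_ball L (INR k) (r / 2) x HL Hno)
      as [n [x' [H1 H2]]]; [lra |].
    destruct (linear_lower_bound_nearby (L n) x' (INR k) (HL n) H2)
      as [r' [Hr' Hy]].
    exists (x', Rmin r' (r / 2)). intros _; simpl. split; [| split; [| split]].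
    - apply Rmin_glb_lt; lra.
    - apply Rmin_r.
    - exact H1.
    - exists n. intros y Hyy. apply Hy.
      eapply Rle_trans; [exact Hyy | apply Rmin_l]. }
  pose (next := fun k p => proj1_sig (constructive_indefinite_description _ (Hstep k p))).
  pose (c := fix c (k : nat) : V * R :=
     match k with O => (zero, 1) | S k => next k (c k) end).
  assert (Hpos : forall k, 0 < snd (c k)).
  { induction k as [| k IH]; simpl; [lra |].
    unfold next. destruct constructive_indefinite_description as [q Hq]; simpl.
    now apply Hq. }
  assert (Hc : forall k,
      snd (c (S k)) <= snd (c k) / 2 /\
      norm (minus (fst (c (S k))) (fst (c k))) <= snd (c k) / 2 /\
      exists n, forall y, norm (minus y (fst (c (S k)))) <= snd (c (S k)) ->
        INR k < norm (L n y)).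
  { intros k. specialize (Hpos k). simpl. unfold next.
    destruct constructive_indefinite_description as [q Hq]; simpl.
    now apply Hq. }
  (* Nesting of balls in the form distance of centres plus inner radius at most outer radius, which
     propagates along the sequence by the triangle inequality. *)
  assert (Hnest : forall k j,
      norm (minus (fst (c (j + k)%nat)) (fst (c k))) + snd (c (j + k)%nat) <= snd (c k)).
  { intros k j. induction j as [| j IH].
    - simpl. rewrite Hminus0. lra.
    - destruct (Hc (j + k)%nat) as [H1 [H2 _]].
      change (S j + k)%nat with (S (j + k)).
      pose proof (Htri (fst (c (S (j + k)))) (fst (c (j + k)%nat)) (fst (c k))). lra. }
  assert (Hsmall : forall k, snd (c k) <= (/ 2) ^ k).
  { induction k as [| k IH]; [simpl; lra |].
    destruct (Hc k) as [H1 _]. rewrite <- tech_pow_Rmult. lra. }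
  assert (Hlim : exists x, filterlim (fun k => fst (c k)) eventually (locally x)).
  { apply (proj1 (@filterlim_locally_cauchy nat
      (CompleteNormedModule.CompleteSpace R_AbsRing V) eventually _
      (fun k => fst (c k)))). intros eps.
    destruct (pow_lt_1_zero (/ 2) ltac:(rewrite Rabs_pos_eq; lra) (eps / 2))
      as [N HN]. { pose proof (cond_pos eps). lra. }
    assert (HN' : snd (c N) < eps / 2).
    { eapply Rle_lt_trans; [apply Hsmall |].
      eapply Rle_lt_trans; [apply Rle_abs | apply HN; apply Nat.le_refl]. }
    assert (Hd : forall u, (N <= u)%nat ->
        norm (minus (fst (c u)) (fst (c N))) < eps / 2).
    { intros u Hu. replace u with ((u - N) + N)%nat by (apply Nat.sub_add; exact Hu).
      pose proof (Hnest N (u - N)%nat). pose proof (Hpos (u - N + N)%nat). lra. }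
    exists (fun u => (N <= u)%nat). split; [now exists N |].
    intros u v Hu Hv. apply (@norm_compat1 R_AbsRing V).
    pose proof (Htri (fst (c v)) (fst (c N)) (fst (c u))) as H3.
    pose proof (Hd u Hu). pose proof (Hd v Hv).
    rewrite (Hsym (fst (c N))) in H3.
    eapply Rle_lt_trans; [exact H3 | lra]. }
  destruct Hlim as [x Hx].
  assert (Hin : forall k, norm (minus x (fst (c k))) <= snd (c k)).
  { intros k. apply Rle_plus_epsilon. intros eps Heps.
    destruct (proj1 (@filterlim_locally_ball_norm R_AbsRing nat V eventually _
      (fun k => fst (c k)) x) Hx (mkposreal eps Heps)) as [N HN].
    assert (HN' : norm (minus (fst (c (N + k)%nat)) x) < eps)
      by exact (HN (N + k)%nat (Nat.le_add_r N k)).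
    pose proof (Htri x (fst (c (N + k)%nat)) (fst (c k))) as H3.
    rewrite (Hsym x (fst (c (N + k)%nat))) in H3.
    pose proof (Hnest k N). pose proof (Hpos (N + k)%nat). lra. }
  destruct (Hpt x) as [M HM].
  (* The limit lies in ball k + 1, on which some [L n] exceeds k > [M]. *)
  destruct (INR_unbounded M) as [k Hk].
  destruct (Hc k) as [_ [_ [n Hn]]].
  specialize (Hn x (Hin (S k))). specialize (HM n). lra.
Qed.

(** * Continuity on the half-line of times *)

Definition continuous_on_halfline {U : UniformSpace} (u : R -> U) : Prop :=
  forall t : R, 0 <= t ->
    filterlim u (within (fun s => 0 <= s) (locally t)) (locally (u t)).

(** Freezing a function at its value at 0 for negative times makes it continuous on all of R, so
    that two-sided results on continuity and integration apply. *)
Lemma continuous_extension {U : UniformSpace} (u : R -> U) :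
  continuous_on_halfline u ->
  forall t : R, continuous (fun s => u (Rmax 0 s)) t.
Proof.
  intros Hu t.
  apply filterlim_comp with (within (fun s => 0 <= s) (locally (Rmax 0 t))).
  - intros P [d Hd]. exists d. intros s Hs. apply Hd; [| apply Rmax_l].
    assert (E : Rabs (s - t) < d) by exact Hs.
    assert (Rabs (Rmax 0 s - Rmax 0 t) < d); [| assumption].
    revert E. unfold Rmax, Rabs. repeat destruct Rle_dec; repeat destruct Rcase_abs; lra.
  - apply Hu, Rmax_l.
Qed.

(** * Geometry and continuity in the Hilbert space *)

Section Hilbert.

Context {H : RealHilbert}.
Implicit Types x y z : H.

Lemma minus_scal x y : minus x y = plus x (scal (-1) y).
Proof.
  change (plus x (opp y) = plus x (scal (-1) y)). f_equal.
  symmetry. exact (@scal_opp_one R_Ring H y).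
Qed.

Lemma inner_plus_r x y z : inner x (plus y z) = inner x y + inner x z.
Proof. rewrite inner_sym, inner_plus_l, (inner_sym y), (inner_sym z). reflexivity. Qed.

Lemma inner_scal_r a x y : inner x (scal a y) = a * inner x y.
Proof. rewrite inner_sym, inner_scal_l, inner_sym. reflexivity. Qed.

Lemma inner_minus_l x y z : inner (minus x y) z = inner x z - inner y z.
Proof. rewrite minus_scal, inner_plus_l, inner_scal_l. ring. Qed.

Lemma inner_minus_r x y z : inner x (minus y z) = inner x y - inner x z.
Proof. rewrite minus_scal, inner_plus_r, inner_scal_r. ring. Qed.

Lemma norm_mul_self x : norm x * norm x = inner x x.
Proof. rewrite inner_norm. apply sqrt_sqrt, inner_pos. Qed.

Lemma norm_nonneg x : 0 <= norm x.
Proof. rewrite inner_norm. apply sqrt_pos. Qed.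

Lemma norm_homogeneous a x : norm (scal a x) = Rabs a * norm x.
Proof.
  rewrite !inner_norm, inner_scal_l, inner_scal_r, <- Rmult_assoc.
  rewrite sqrt_mult_alt by apply Rle_0_sqr.
  f_equal. apply sqrt_Rsqr_abs.
Qed.

Lemma norm_plus_le x y : norm (plus x y) <= norm x + norm y.
Proof. exact (@norm_triangle _ H x y). Qed.

Lemma norm_minus_sym x y : norm (minus x y) = norm (minus y x).
Proof.
  rewrite !inner_norm, !inner_minus_l, !inner_minus_r. f_equal. ring.
Qed.

Lemma norm_minus_le x y z : norm (minus x z) <= norm (minus x y) + norm (minus y z).
Proof. rewrite (minus_trans y x z). apply norm_plus_le. Qed.

Lemma norm_le_minus x y : norm x <= norm y + norm (minus x y).
Proof.
  replace x with (plus y (minus x y)) at 1; [apply norm_plus_le |].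
  exact (plus_minus_r (G := H) x y).
Qed.

Lemma Cauchy_Schwarz x y : Rabs (inner x y) <= norm x * norm y.
Proof.
  pose proof (norm_nonneg x) as Hx. pose proof (norm_nonneg y) as Hy.
  (* For nonzero [y], this square expands to |y|^2 (|x|^2 |y|^2 - <x, y>^2), and the factor |y|^2 is
     cancelled at the end. *)
  pose proof (inner_pos (minus (scal (inner y y) x) (scal (inner x y) y))) as Hp.
  rewrite ?inner_minus_l, ?inner_minus_r, ?inner_scal_l, ?inner_scal_r,
    (inner_sym y x) in Hp.
  destruct (Req_dec (norm y) 0) as [E | E].
  - assert (Ey : y = zero).
    { apply inner_def. rewrite <- norm_mul_self, E. ring. }
    assert (E0 : inner x y = 0).
    { assert (Hz : inner x (scal 0 y) = 0) by (rewrite inner_scal_r; ring).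
      replace (scal 0 y) with y in Hz; [exact Hz |].
      rewrite Ey. symmetry. exact (@scal_zero_r R_Ring H 0). }
    rewrite E0, Rabs_R0, E. lra.
  - rewrite <- (Rabs_pos_eq (norm x * norm y)) by (apply Rmult_le_pos; assumption).
    apply Rsqr_le_abs_0. unfold Rsqr.
    rewrite <- (norm_mul_self y), <- (norm_mul_self x) in Hp.
    assert (Hy' : 0 < norm y * norm y) by nra.
    apply Rmult_le_reg_l with (norm y * norm y); [assumption |]. nra.
Qed.

Lemma continuous_norm_sq (u : R -> H) (t : R) :
  continuous u t -> continuous (fun s => inner (u s) (u s)) t.
Proof.
  intros Hu.
  apply continuous_ext with (fun s => mult (norm (u s)) (norm (u s))).
  { intros s. apply norm_mul_self. }
  assert (Hn : continuous (fun s => norm (u s)) t).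
  { apply (continuous_comp u norm); [exact Hu | exact (@filterlim_norm _ H (u t))]. }
  exact (continuous_mult (K := R_AbsRing) _ _ _ Hn Hn).
Qed.

(** Polarization reduces the inner product to squared norms, whose continuity is that of the
    norm. *)
Lemma continuous_inner (u v : R -> H) (t : R) :
  continuous u t -> continuous v t -> continuous (fun s => inner (u s) (v s)) t.
Proof.
  intros Hu Hv.
  apply continuous_ext with (fun s => scal (/ 4)
    (minus (inner (plus (u s) (v s)) (plus (u s) (v s)))
           (inner (minus (u s) (v s)) (minus (u s) (v s))))).
  { intros s. rewrite !inner_minus_l, !inner_minus_r, !inner_plus_l, !inner_plus_r.
    rewrite (inner_sym (v s) (u s)).
    unfold scal, minus, plus, opp; simpl. unfold mult; simpl. field. }
  apply (continuous_scal_r (/ 4) (V := R_NormedModule)).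
  apply (continuous_minus (V := R_NormedModule)); apply continuous_norm_sq.
  - exact (@continuous_plus R_UniformSpace R_AbsRing H _ _ _ Hu Hv).
  - exact (@continuous_minus R_UniformSpace R_AbsRing H _ _ _ Hu Hv).
Qed.

Lemma continuous_on_halfline_norm (u : R -> H) :
  continuous_on_halfline u <->
  forall t : R, 0 <= t -> forall eps : R, 0 < eps ->
    exists delta : R, 0 < delta /\ forall s : R, 0 <= s ->
      Rabs (s - t) < delta -> norm (minus (u s) (u t)) < eps.
Proof.
  split.
  - intros Hu t Ht eps Heps.
    destruct (proj1 (@filterlim_locally_ball_norm R_AbsRing R H _ _ _ _)
      (Hu t Ht) (mkposreal eps Heps)) as [d Hd].
    exists d. split; [apply cond_pos |]. intros s Hs Hst. exact (Hd s Hst Hs).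
  - intros Hu t Ht.
    apply (@filterlim_locally_ball_norm R_AbsRing R H); [exact _ |].
    intros eps. destruct (Hu t Ht eps (cond_pos eps)) as [d [Hd Hs]].
    exists (mkposreal d Hd). intros s Hst Hs0. exact (Hs s Hs0 Hst).
Qed.

Lemma continuous_on_halfline_plus (u v : R -> H) :
  continuous_on_halfline u -> continuous_on_halfline v ->
  continuous_on_halfline (fun t => plus (u t) (v t)).
Proof.
  intros Hu Hv t Ht.
  eapply filterlim_comp_2; [exact (Hu t Ht) | exact (Hv t Ht) |].
  exact (@filterlim_plus R_AbsRing H (u t) (v t)).
Qed.

Lemma continuous_on_halfline_linear (l : H -> H) (u : R -> H) :
  is_linear l -> continuous_on_halfline u ->
  continuous_on_halfline (fun t => l (u t)).
Proof.
  intros Hl Hu t Ht.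
  eapply filterlim_comp; [exact (Hu t Ht) |].
  exact (linear_cont l (u t) Hl).
Qed.

Lemma is_linear_homothety (a : R) : is_linear (fun x : H => scal a x).
Proof. exact (@is_linear_scal_r R_AbsRing H a Rmult_comm). Qed.

End Hilbert.

(** * Mild solutions of the inhomogeneous equation *)

Section Mild.

Context {H : RealHilbert} (S : R -> H -> H).
Hypothesis HS : C0_semigroup S.
Hypothesis Hiso : isometric_family S.
Implicit Types x y z : H.

(** The Duhamel formula for u' = A u + f, u(0) = x. With the forcing as a separate argument the
    relation is linear in (f, u, x), so solutions can be added, scaled and compared with free
    orbits. *)
Definition mild (f u : R -> H) (x : H) : Prop :=
  forall t : R, 0 <= t ->
    exists I : H, is_RInt (fun s => S (t - s) (f s)) 0 t I /\
                  u t = plus (S t x) I.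

Lemma semigroup_modulus x (eps : R) :
  0 < eps ->
  exists delta : R, 0 < delta /\
    forall h : R, 0 <= h < delta -> norm (minus (S h x) x) < eps.
Proof.
  intros Heps.
  destruct (proj1 (@filterlim_locally_ball_norm R_AbsRing R H _ _ _ _)
      (C0_cont HS (x := x)) (mkposreal eps Heps)) as [d Hd].
  exists d. split; [apply cond_pos |]. intros h [Hh0 Hh].
  destruct (Req_dec h 0) as [-> | Hne].
  - rewrite (C0_zero HS), inner_norm, inner_minus_l, inner_minus_r.
    replace (_ - _) with 0 by ring. rewrite sqrt_0. assumption.
  - apply (Hd h); [| lra].
    assert (E : Rabs (h - 0) < d); [| exact E].
    rewrite Rabs_pos_eq; lra.
Qed.

(** The isometry [S a] can be stripped off, so right continuity at 0 alone controls increments on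
    both sides of any time. *)
Lemma orbit_increment x (a b : R) :
  0 <= a <= b -> norm (minus (S b x) (S a x)) = norm (minus (S (b - a) x) x).
Proof.
  intros Hab.
  replace (S b x) with (S a (S (b - a) x)).
  - rewrite <- (Hiso a (minus (S (b - a) x) x)) by lra. f_equal.
    symmetry. exact (linear_minus _ _ _ (C0_linear HS (proj1 Hab))).
  - rewrite <- (C0_add HS) by lra. f_equal. ring.
Qed.

Lemma orbit_continuous x : continuous_on_halfline (fun t => S t x).
Proof.
  apply continuous_on_halfline_norm. intros t Ht eps Heps.
  destruct (semigroup_modulus x eps Heps) as [d [Hd Hx]].
  exists d. split; [assumption |]. intros s Hs Hst.
  apply Rabs_lt_between in Hst.
  destruct (Rle_dec t s) as [Hts | Hts].
  - rewrite orbit_increment by lra. apply Hx. lra.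
  - rewrite norm_minus_sym, orbit_increment by lra. apply Hx. lra.
Qed.

Lemma mild_zero (f u : R -> H) x : mild f u x -> u 0 = x.
Proof.
  intros Hu. destruct (Hu 0 (Rle_refl 0)) as [I [HI ->]].
  rewrite (C0_zero HS).
  apply is_RInt_unique in HI. rewrite RInt_point in HI. rewrite <- HI.
  exact (plus_zero_r (G := H) x).
Qed.

(** Restarting at time a: [S (b - a)] applied to the integral up to a is the part over [0, a] of the
    integral up to b, by the semigroup law. *)
Lemma mild_step (f u : R -> H) x (a b : R) :
  mild f u x -> 0 <= a <= b ->
  exists J : H, is_RInt (fun s => S (b - s) (f s)) a b J /\
    u b = plus (S (b - a) (u a)) J.
Proof.
  intros Hu [Ha Hab].
  destruct (Hu a Ha) as [Ia [HIa ->]].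
  destruct (Hu b ltac:(lra)) as [Ib [HIb ->]].
  assert (Hl : is_linear (S (b - a))) by (apply (C0_linear HS); lra).
  exists (plus (opp (S (b - a) Ia)) Ib). split.
  - apply (@is_RInt_Chasles H) with 0; [| exact HIb].
    apply (@is_RInt_swap H).
    apply (@is_RInt_ext H) with (fun s => S (b - a) (S (a - s) (f s))).
    + intros s Hs. rewrite Rmin_left, Rmax_right in Hs by lra.
      rewrite <- (C0_add HS) by lra. f_equal. ring.
    + exact (is_RInt_linear (S (b - a)) _ 0 a Ia Hl HIa).
  - etransitivity; [| symmetry; apply (f_equal (fun w => plus w _));
      exact (linear_plus _ Hl (S a x) Ia)].
    rewrite <- (C0_add HS) by lra. replace (b - a + a) with b by ring.
    assert (E : forall (p q r : H), plus p r = plus (plus p q) (plus (opp q) r)).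
    { intros p q r. rewrite <- plus_assoc. f_equal. rewrite plus_assoc.
      etransitivity; [symmetry; exact (plus_zero_l (G := H) r) |].
      f_equal. symmetry. exact (plus_opp_r (G := H) q). }
    apply E.
Qed.

Lemma mild_plus (f g u v : R -> H) x y :
  mild f u x -> mild g v y ->
  mild (fun t => plus (f t) (g t)) (fun t => plus (u t) (v t)) (plus x y).
Proof.
  intros Hu Hv t Ht.
  destruct (Hu t Ht) as [I [HI ->]]. destruct (Hv t Ht) as [J [HJ ->]].
  exists (plus I J). split.
  - apply (@is_RInt_ext H) with (fun s => plus (S (t - s) (f s)) (S (t - s) (g s))).
    + intros s Hs. rewrite Rmin_left, Rmax_right in Hs by lra.
      symmetry. apply (linear_plus (S (t - s))), (C0_linear HS). lra.
    + exact (is_RInt_plus (V := H) _ _ _ _ _ _ HI HJ).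
  - etransitivity; [| symmetry; apply (f_equal (fun w => plus w _));
      exact (linear_plus _ (C0_linear HS Ht) x y)].
    rewrite <- !plus_assoc. f_equal. rewrite !plus_assoc. f_equal. apply plus_comm.
Qed.

Lemma mild_scal (f u : R -> H) x (k : R) :
  mild f u x -> mild (fun t => scal k (f t)) (fun t => scal k (u t)) (scal k x).
Proof.
  intros Hu t Ht.
  destruct (Hu t Ht) as [I [HI ->]].
  exists (scal k I). split.
  - apply (@is_RInt_ext H) with (fun s => scal k (S (t - s) (f s))).
    + intros s Hs. rewrite Rmin_left, Rmax_right in Hs by lra.
      symmetry. apply (linear_scal (S (t - s))), (C0_linear HS). lra.
    + exact (is_RInt_scal (V := H) _ _ _ k _ HI).
  - etransitivity; [exact (linear_plus _ (is_linear_homothety k) (S t x) I) |].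
    f_equal. symmetry. exact (linear_scal _ (C0_linear HS Ht) k x).
Qed.

Lemma mild_orbit x : mild (fun _ => zero) (fun t => S t x) x.
Proof.
  intros t Ht. exists zero. split.
  - apply (@is_RInt_ext H) with (fun _ => zero).
    + intros s Hs. rewrite Rmin_left, Rmax_right in Hs by lra.
      symmetry. apply (linear_zero (S (t - s))), (C0_linear HS). lra.
    + exact (eq_ind _ (is_RInt (fun _ => @zero H) 0 t)
        (is_RInt_const (V := H) 0 t zero) _ (@scal_zero_r R_Ring H (t - 0))).
  - symmetry. exact (plus_zero_r (G := H) (S t x)).
Qed.

(** First-order expansion of the Duhamel term, uniform over short intervals near t. Half of [eta]
    pays for replacing f(s) by f(t), which the isometry passes through [S (b - s)]; the other half
    pays for replacing [S (b - s)] by the identity at the fixed vector f(t). *)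
Lemma convolution_increment (f : R -> H) (t eta : R) :
  continuous_on_halfline f -> 0 <= t -> 0 < eta ->
  exists delta : R, 0 < delta /\ forall (a b : R) (J : H),
    0 <= a <= b -> Rabs (a - t) < delta -> Rabs (b - t) < delta ->
    is_RInt (fun s => S (b - s) (f s)) a b J ->
    norm (minus J (scal (b - a) (f t))) <= (b - a) * eta.
Proof.
  intros Hf Ht Heta.
  destruct (proj1 (continuous_on_halfline_norm f) Hf t Ht (eta / 2) ltac:(lra))
    as [d1 [Hd1 Hf1]].
  destruct (semigroup_modulus (f t) (eta / 2) ltac:(lra)) as [d2 [Hd2 Hf2]].
  (* Two points within d2 / 2 of t are less than d2 apart, as the modulus at f(t) requires. *)
  exists (Rmin d1 (d2 / 2)). split; [apply Rmin_glb_lt; lra |].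
  intros a b J Hab Ha Hb HJ.
  pose proof (Rmin_l d1 (d2 / 2)). pose proof (Rmin_r d1 (d2 / 2)).
  apply Rabs_lt_between in Ha. apply Rabs_lt_between in Hb.
  apply (@norm_RInt_le H) with
    (f := fun s => minus (S (b - s) (f s)) (f t)) (g := fun _ => eta) (a := a) (b := b).
  - lra.
  - intros s Hs.
    eapply Rle_trans; [exact (norm_minus_le _ (S (b - s) (f t)) _) |].
    assert (E : norm (minus (S (b - s) (f s)) (S (b - s) (f t))) < eta / 2).
    { eapply Rle_lt_trans; [| apply (Hf1 s); [lra | apply Rabs_lt_between; lra]].
      right. rewrite <- (Hiso (b - s) (minus (f s) (f t))) by lra.
      f_equal. symmetry.
      apply (linear_minus (S (b - s))), (C0_linear HS). lra. }
    pose proof (Hf2 (b - s) ltac:(lra)). lra.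
  - exact (is_RInt_minus (V := H) _ _ _ _ _ _ HJ (is_RInt_const (V := H) a b (f t))).
  - exact (is_RInt_const (V := R_NormedModule) a b eta).
Qed.

End Mild.

(** * The energy identity for mild solutions *)

Section Energy.

Context {H : RealHilbert} (S : R -> H -> H).
Hypothesis HS : C0_semigroup S.
Hypothesis Hiso : isometric_family S.
Context (f u : R -> H) (x : H).
Hypothesis Hf : continuous_on_halfline f.
Hypothesis Hu : continuous_on_halfline u.
Hypothesis Hmild : mild S f u x.

(** Both endpoints vary near t, so difference quotients from either side are covered. With h = b -
    a, the error in 2 <u(b), J> - |J|^2 has three sources: u(b) in place of u(t), J in place of h
    f(t), and |J|^2, which is of order h^2. *)
Lemma energy_increment (t eta : R) :
  0 < t -> 0 < eta ->
  exists delta : R, 0 < delta /\ forall a b : R,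
    a <= b -> Rabs (a - t) < delta -> Rabs (b - t) < delta ->
    Rabs (inner (u b) (u b) - inner (u a) (u a) - (b - a) * (2 * inner (u t) (f t)))
      <= (b - a) * eta.
Proof.
  intros Ht Heta0.
  pose (F := norm (f t)). pose (U := norm (u t)).
  assert (HF : 0 <= F) by apply norm_nonneg.
  assert (HU : 0 <= U) by apply norm_nonneg.
  (* With h = b - a and the tolerance [e] chosen next, the three errors are at most 2 h e F, 2 h e
     (U + 1) and h e (F + 1)^2, in all h e K. *)
  pose (K := 2 * F + 2 * (U + 1) + (F + 1) * (F + 1)).
  assert (HK : 0 < K) by (unfold K; nra).
  pose (e := Rmin 1 (eta / K)).
  assert (He : 0 < e <= 1 /\ e * K <= eta).
  { assert (0 < eta / K) by (apply Rdiv_lt_0_compat; assumption).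
    pose proof (Rmin_l 1 (eta / K)). pose proof (Rmin_r 1 (eta / K)).
    split; [split |]; [apply Rmin_glb_lt; lra | assumption |].
    replace eta with (eta / K * K) by (field; lra).
    apply Rmult_le_compat_r; unfold e; lra. }
  clearbody e. destruct He as [[He0 He1] HeK].
  destruct (convolution_increment S HS Hiso f t e Hf (Rlt_le _ _ Ht) He0)
    as [d1 [Hd1 HJ1]].
  destruct (proj1 (continuous_on_halfline_norm u) Hu t (Rlt_le _ _ Ht) e He0)
    as [d2 [Hd2 Hu2]].
  (* The bound [e / 2] forces h <= e, which trades h^2 for h e; the bound [t] keeps a positive. *)
  exists (Rmin (Rmin d1 d2) (Rmin (e / 2) t)).
  split; [repeat apply Rmin_glb_lt; lra |].
  intros a b Hab Ha Hb.
  assert (Hm : Rmin (Rmin d1 d2) (Rmin (e / 2) t) <= d1 /\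
     Rmin (Rmin d1 d2) (Rmin (e / 2) t) <= d2 /\
     Rmin (Rmin d1 d2) (Rmin (e / 2) t) <= e / 2 /\
     Rmin (Rmin d1 d2) (Rmin (e / 2) t) <= t).
  { unfold Rmin. repeat destruct Rle_dec; lra. }
  assert (Ha' := Ha). assert (Hb' := Hb).
  apply Rabs_lt_between in Ha'. apply Rabs_lt_between in Hb'.
  destruct (mild_step S HS f u x a b Hmild ltac:(lra)) as [J [HJ Hstep]].
  pose proof (HJ1 a b J ltac:(lra) ltac:(lra) ltac:(lra) HJ) as HJe.
  pose proof (Hu2 b ltac:(lra) ltac:(lra)) as Hub.
  pose (h := b - a). fold h in HJe |- *.
  assert (Hh : 0 <= h <= e) by (unfold h; lra).
  pose (r := minus J (scal h (f t))). fold r in HJe.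
  assert (Hinc : inner (u b) (u b) - inner (u a) (u a)
      = 2 * inner (u b) J - inner J J).
  { assert (Hn : inner (u a) (u a) = inner (minus (u b) J) (minus (u b) J)).
    { rewrite <- !norm_mul_self, <- (Hiso h (u a)) by lra.
      replace (minus (u b) J) with (S h (u a)); [reflexivity |].
      rewrite Hstep, plus_comm. symmetry.
      exact (minus_plus_l (G := H) J (S h (u a))). }
    rewrite Hn, !inner_minus_l, !inner_minus_r, (inner_sym J (u b)). ring. }
  assert (HuJ : inner (u b) J = h * inner (u b) (f t) + inner (u b) r).
  { unfold r. rewrite inner_minus_r, inner_scal_r. ring. }
  assert (Hubt : inner (u b) (f t) = inner (u t) (f t) + inner (minus (u b) (u t)) (f t)).
  { rewrite inner_minus_l. ring. }
  assert (B1 : Rabs (inner (minus (u b) (u t)) (f t)) <= e * F).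
  { eapply Rle_trans; [apply Cauchy_Schwarz |].
    apply Rmult_le_compat_r; [exact HF | lra]. }
  assert (B2 : Rabs (inner (u b) r) <= (U + 1) * (h * e)).
  { eapply Rle_trans; [apply Cauchy_Schwarz |].
    apply Rmult_le_compat; [apply norm_nonneg | apply norm_nonneg | | exact HJe].
    pose proof (norm_le_minus (u b) (u t)). unfold U. lra. }
  assert (B3 : 0 <= inner J J <= h * e * ((F + 1) * (F + 1))).
  { split; [apply inner_pos |].
    assert (HJn : norm J <= h * (F + 1)).
    { pose proof (norm_le_minus J (scal h (f t))) as E.
      fold r in E. rewrite norm_homogeneous, Rabs_pos_eq in E by lra.
      fold F in E. nra. }
    rewrite <- norm_mul_self. pose proof (norm_nonneg J).
    apply Rle_trans with ((h * (F + 1)) * (h * (F + 1))).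
    - apply Rmult_le_compat; assumption.
    - replace (h * (F + 1) * (h * (F + 1))) with (h * h * ((F + 1) * (F + 1))) by ring.
      apply Rmult_le_compat_r; [nra |]. apply Rmult_le_compat_l; lra. }
  rewrite Hinc, HuJ, Hubt.
  apply Rabs_le_between in B1. apply Rabs_le_between in B2.
  assert (B1' : - (h * (e * F)) <= h * inner (minus (u b) (u t)) (f t) <= h * (e * F)).
  { split.
    - replace (- (h * (e * F))) with (h * - (e * F)) by ring.
      apply Rmult_le_compat_l; lra.
    - apply Rmult_le_compat_l; lra. }
  assert (HKe : h * (e * K) <= h * eta) by (apply Rmult_le_compat_l; lra).
  unfold K in HKe.
  apply Rabs_le_between. split; nra.
Qed.

Lemma energy_derive (t : R) :
  0 < t -> is_derive (fun s => inner (u s) (u s)) t (2 * inner (u t) (f t)).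
Proof.
  intros Ht. apply is_derive_Reals. intros eps Heps.
  (* Halving leaves room for the strict inequality in the definition of the derivative. *)
  destruct (energy_increment t (eps / 2) Ht ltac:(lra)) as [d [Hd Hinc]].
  exists (mkposreal d Hd). intros h Hh Hhd. simpl in Hhd.
  assert (H0 : Rabs (t - t) < d) by (rewrite Rminus_diag, Rabs_R0; assumption).
  assert (H1 : Rabs (t + h - t) < d) by (replace (t + h - t) with h by ring; assumption).
  set (D := 2 * inner (u t) (f t)) in *.
  set (q := inner (u (t + h)) (u (t + h)) - inner (u t) (u t)).
  assert (E : Rabs (q - h * D) <= Rabs h * (eps / 2)).
  { destruct (Rle_dec 0 h) as [Hp | Hn].
    - pose proof (Hinc t (t + h) ltac:(lra) H0 H1) as E.
      replace (t + h - t) with h in E by ring.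
      rewrite (Rabs_pos_eq h) by lra. exact E.
    - pose proof (Hinc (t + h) t ltac:(lra) H1 H0) as E.
      replace (t - (t + h)) with (- h) in E by ring.
      rewrite (Rabs_left h) by lra. rewrite Rabs_minus_sym.
      unfold q. eapply Rle_trans; [right | exact E]. f_equal. ring. }
  replace (q / h - D) with ((q - h * D) / h) by (field; assumption).
  unfold Rdiv at 1. rewrite Rabs_mult, Rabs_inv.
  pose proof (Rabs_pos_lt h Hh) as Hpos.
  apply Rmult_lt_reg_r with (Rabs h); [assumption |].
  rewrite Rmult_assoc, Rinv_l by lra. nra.
Qed.

(** The derivative is known only for t > 0, so the mean value theorem is applied to the energy minus
    the integral of its derivative, both extended to negative times: continuous on [0, T] and of
    zero derivative inside. *)
Lemma energy_identity (T : R) :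
  0 < T ->
  is_RInt (fun t => 2 * inner (u t) (f t)) 0 T (inner (u T) (u T) - inner x x).
Proof.
  intros HT.
  pose (k := fun s => scal 2 (inner (u (Rmax 0 s)) (f (Rmax 0 s)))).
  assert (Hk : forall s, continuous k s).
  { intros s. apply (continuous_scal_r 2 (V := R_NormedModule)).
    apply continuous_inner; apply continuous_extension; assumption. }
  assert (Hk' : forall b, is_RInt k 0 b (RInt k 0 b)).
  { intros b. apply (RInt_correct (V := R_CompleteNormedModule)).
    apply (ex_RInt_continuous (V := R_CompleteNormedModule)). intros s _. apply Hk. }
  assert (Hint : forall t, is_derive (RInt k 0) t (k t)).
  { intros t. apply (is_derive_RInt k (RInt k 0) 0 t); [| apply Hk].
    apply filter_forall. exact Hk'. }
  pose (phi := fun s => minus (inner (u (Rmax 0 s)) (u (Rmax 0 s))) (RInt k 0 s)).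
  destruct (MVT_gen phi 0 T (fun _ => 0)) as [c [_ Hc]].
  - intros t Ht. rewrite Rmin_left, Rmax_right in Ht by lra.
    replace 0 with (minus (k t) (k t)) by (apply (minus_eq_zero (G := R_AbelianGroup))).
    apply (is_derive_minus (V := R_NormedModule)); [| apply Hint].
    apply is_derive_ext_loc with (fun s => inner (u s) (u s)).
    + apply (filter_imp (fun s => 0 < s)).
      * intros s Hs. rewrite Rmax_right by lra. reflexivity.
      * apply (open_gt 0). apply Ht.
    + unfold k. rewrite Rmax_right by lra. apply energy_derive. apply Ht.
  - intros t _. apply continuity_pt_filterlim.
    apply (continuous_minus (V := R_NormedModule)).
    + apply continuous_norm_sq, continuous_extension, Hu.
    + apply (ex_derive_continuous (V := R_NormedModule)). eexists. apply Hint.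
  - apply (is_RInt_ext (V := R_NormedModule) k).
    + intros s Hs. rewrite Rmin_left, Rmax_right in Hs by lra.
      unfold k. rewrite Rmax_right by lra. reflexivity.
    + replace (inner (u T) (u T) - inner x x) with (RInt k 0 T); [apply Hk' |].
      unfold phi, minus, plus, opp in Hc; simpl in Hc.
      rewrite (Rmax_right 0 T), Rmax_left in Hc by lra.
      rewrite (mild_zero S HS f u x Hmild) in Hc.
      assert (E : RInt k 0 0 = 0) by apply (RInt_point (V := R_CompleteNormedModule)).
      lra.
Qed.

End Energy.

Lemma mild_of_mild_solution {H : RealHilbert} (S : R -> H -> H) (B : H -> H)
    (c : R) (x : H) (z : R -> H) :
  C0_semigroup S -> mild_solution S B c x z -> mild S (fun t => scal c (B (z t))) z x.
Proof.
  intros HS [_ Hz] t Ht. destruct (Hz t Ht) as [I [HI E]].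
  exists (scal c I). split; [| exact E].
  apply (@is_RInt_ext H) with (fun s => scal c (S (t - s) (B (z s)))).
  - intros s Hs. rewrite Rmin_left, Rmax_right in Hs by lra.
    symmetry. apply (linear_scal (S (t - s))), (C0_linear HS). lra.
  - exact (is_RInt_scal (V := H) _ _ _ c _ HI).
Qed.

Lemma mild_ext {H : RealHilbert} (S : R -> H -> H) (f g u : R -> H) (x : H) :
  (forall t, 0 <= t -> f t = g t) -> mild S f u x -> mild S g u x.
Proof.
  intros E Hu t Ht. destruct (Hu t Ht) as [I [HI HuI]].
  exists I. split; [| exact HuI].
  apply (@is_RInt_ext H) with (2 := HI). intros s Hs.
  rewrite Rmin_left, Rmax_right in Hs by lra. rewrite E by lra. reflexivity.
Qed.

(** * The closed loop: monotonicity, linearity, uniform decay and deviation from the free orbit *)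

Section ClosedLoop.

Context {H : RealHilbert} (S : R -> H -> H) (B : H -> H) (c : R).
Hypothesis HS : C0_semigroup S.
Hypothesis Hiso : isometric_family S.
Hypothesis HBlin : is_linear B.
Hypothesis HBpos : positive_operator B.

Definition closed_loop (u : R -> H) (x : H) : Prop :=
  continuous_on_halfline u /\ mild S (fun t => scal c (B (u t))) u x.

Lemma closed_loop_of_mild_solution (x : H) (z : R -> H) :
  mild_solution S B c x z -> closed_loop z x.
Proof.
  intros [Hc Hz]. split; [exact Hc |].
  apply mild_of_mild_solution; [assumption | split; assumption].
Qed.

Lemma continuous_feedback (u : R -> H) :
  continuous_on_halfline u -> continuous_on_halfline (fun t => scal c (B (u t))).
Proof.
  intros Hu.
  apply (continuous_on_halfline_linear (fun y => scal c (B y)) u); [| exact Hu].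
  exact (is_linear_comp B _ HBlin (is_linear_homothety c)).
Qed.

Lemma closed_loop_plus (u v : R -> H) (x y : H) :
  closed_loop u x -> closed_loop v y ->
  closed_loop (fun t => plus (u t) (v t)) (plus x y).
Proof.
  intros [Cu Mu] [Cv Mv]. split; [apply continuous_on_halfline_plus; assumption |].
  apply mild_ext with (2 := mild_plus S HS _ _ u v x y Mu Mv).
  intros t _.
  etransitivity; [symmetry;
    exact (linear_plus _ (is_linear_homothety c) (B (u t)) (B (v t))) |].
  f_equal. symmetry. exact (linear_plus B HBlin (u t) (v t)).
Qed.

Lemma closed_loop_scal (a : R) (u : R -> H) (x : H) :
  closed_loop u x -> closed_loop (fun t => scal a (u t)) (scal a x).
Proof.
  intros [Cu Mu]. split.
  - apply (continuous_on_halfline_linear (fun y => scal a y));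
      [apply is_linear_homothety | exact Cu].
  - apply mild_ext with (2 := mild_scal S HS _ u x a Mu).
    intros t _.
    etransitivity; [exact (linear_scal _ (is_linear_homothety a) c (B (u t))) |].
    f_equal. symmetry. exact (linear_scal B HBlin a (u t)).
Qed.

Lemma closed_loop_energy (u : R -> H) (x : H) (T : R) :
  closed_loop u x -> 0 < T ->
  is_RInt (fun t => 2 * inner (u t) (scal c (B (u t)))) 0 T
    (inner (u T) (u T) - inner x x).
Proof.
  intros [Cu Mu] HT.
  apply (energy_identity S HS Hiso); [apply continuous_feedback | | |]; assumption.
Qed.

Lemma norm_le_of_inner_le (x y : H) : inner x x <= inner y y -> norm x <= norm y.
Proof. intros E. rewrite !inner_norm. apply sqrt_le_1_alt, E. Qed.

Lemma closed_loop_nonincreasing (u : R -> H) (x : H) (T : R) :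
  c <= 0 -> closed_loop u x -> 0 < T -> norm (u T) <= norm x.
Proof.
  intros Hc Hu HT. apply norm_le_of_inner_le.
  assert (E : inner (u T) (u T) - inner x x <= 0); [| lra].
  apply (is_RInt_le (fun t => 2 * inner (u t) (scal c (B (u t)))) (fun _ => 0) 0 T).
  - lra.
  - apply closed_loop_energy; assumption.
  - replace 0 with (scal (T - 0) 0) at 2 by (apply Rmult_0_r).
    apply (is_RInt_const (V := R_NormedModule)).
  - intros t _. rewrite inner_scal_r, inner_sym.
    pose proof (proj2 HBpos (u t)). nra.
Qed.

Lemma closed_loop_nondecreasing (u : R -> H) (x : H) (T : R) :
  0 <= c -> closed_loop u x -> 0 < T -> norm x <= norm (u T).
Proof.
  intros Hc Hu HT. apply norm_le_of_inner_le.
  assert (E : 0 <= inner (u T) (u T) - inner x x); [| lra].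
  apply (is_RInt_le (fun _ => 0) (fun t => 2 * inner (u t) (scal c (B (u t)))) 0 T).
  - lra.
  - replace 0 with (scal (T - 0) 0) at 2 by (apply Rmult_0_r).
    apply (is_RInt_const (V := R_NormedModule)).
  - apply closed_loop_energy; assumption.
  - intros t _. rewrite inner_scal_r, inner_sym.
    pose proof (proj2 HBpos (u t)). nra.
Qed.

(** The difference is a closed-loop solution starting at 0, and its norm cannot grow. This is what
    makes the solution map linear in the initial state. *)
Lemma closed_loop_unique (u v : R -> H) (x : H) (T : R) :
  c <= 0 -> closed_loop u x -> closed_loop v x -> 0 < T -> u T = v T.
Proof.
  intros Hc Hu Hv HT.
  pose proof (closed_loop_nonincreasing _ _ T Hc
    (closed_loop_plus _ _ _ _ Hu (closed_loop_scal (-1) v x Hv)) HT) as E.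
  cbv beta in E. rewrite <- !minus_scal in E.
  assert (E0 : norm (minus x x) = 0).
  { rewrite inner_norm, inner_minus_l, Rminus_diag, sqrt_0. reflexivity. }
  assert (E1 : minus (u T) (v T) = zero).
  { apply inner_def. rewrite <- norm_mul_self.
    pose proof (norm_nonneg (minus (u T) (v T))).
    replace (norm (minus (u T) (v T))) with 0 by lra. ring. }
  etransitivity; [symmetry; exact (plus_minus_r (G := H) (u T) (v T)) |].
  etransitivity; [exact (f_equal (plus (v T)) E1) |].
  exact (plus_zero_r (G := H) (v T)).
Qed.

(* The decay rates depend on the initial state, but they bound [n * z(n)] for
   each of them, and the uniform boundedness principle applied to these
   operators gives a uniform decay. *)
Lemma uniform_contraction_time (Z : H -> R -> H) :
  c <= 0 ->
  (forall x, closed_loop (Z x) x) ->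
  (forall x, exists M sigma, 0 < M /\ 0 < sigma /\
     forall t, 0 <= t -> norm (Z x t) <= M * exp (- sigma * t) * norm x) ->
  exists T, 0 < T /\ forall x, norm (Z x T) <= norm x / 2.
Proof.
  intros Hc HZ Hdecay.
  (* The times n + 1 start at 1, since contractivity and uniqueness are stated for positive
     times. *)
  pose (L := fun (n : nat) (x : H) =>
    scal (INR (Datatypes.S n)) (Z x (INR (Datatypes.S n)))).
  assert (Hpos : forall n, 0 < INR (Datatypes.S n))
    by (intros n; apply lt_0_INR, Nat.lt_0_succ).
  assert (HL : forall n, is_linear (L n)).
  { intros n. specialize (Hpos n). unfold L.
    apply (is_linear_comp (fun x => Z x (INR (Datatypes.S n))));
      [| apply is_linear_homothety].
    constructor.
    - intros x y.
      apply (closed_loop_unique (Z (plus x y)) (fun t => plus (Z x t) (Z y t))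
        (plus x y));
        [assumption | apply HZ | apply closed_loop_plus; apply HZ | assumption].
    - intros a x.
      apply (closed_loop_unique (Z (scal a x)) (fun t => scal a (Z x t)) (scal a x));
        [assumption | apply HZ | apply closed_loop_scal; apply HZ | assumption].
    - exists 1. split; [lra |]. intros x. rewrite Rmult_1_l.
      apply closed_loop_nonincreasing; [assumption | apply HZ | assumption]. }
  destruct (uniform_boundedness L HL) as [C HC].
  - intros x. destruct (Hdecay x) as [M [sigma [HM [Hsig Hx]]]].
    exists (M / sigma * norm x). intros n. unfold L.
    pose proof (Hpos n) as Hn. set (t := INR (Datatypes.S n)) in *.
    rewrite norm_homogeneous, Rabs_pos_eq by lra.
    apply Rle_trans with (t * (M * exp (- sigma * t) * norm x)).
    { apply Rmult_le_compat_l; [lra | apply Hx; lra]. }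
    replace (t * (M * exp (- sigma * t) * norm x))
      with (M / sigma * ((sigma * t) * exp (- sigma * t)) * norm x) by (field; lra).
    apply Rmult_le_compat_r; [apply norm_nonneg |].
    rewrite <- (Rmult_1_r (M / sigma)) at 2.
    apply Rmult_le_compat_l; [apply Rlt_le, Rdiv_lt_0_compat; lra |].
    (* With s = sigma t, s exp(-s) <= 1 because s <= 1 + s <= exp(s). *)
    replace 1 with (exp (sigma * t) * exp (- sigma * t)).
    + apply Rmult_le_compat_r; [apply Rlt_le, exp_pos |].
      pose proof (exp_ineq1_le (sigma * t)). lra.
    + rewrite <- exp_plus, <- exp_0. f_equal. ring.
  - destruct (INR_unbounded (2 * C)) as [n Hn].
    assert (Hn' : 2 * C < INR (Datatypes.S n)) by (rewrite S_INR; lra).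
    exists (INR (Datatypes.S n)). split; [apply Hpos |]. intros x.
    specialize (HC n x). specialize (Hpos n). unfold L in HC.
    set (t := INR (Datatypes.S n)) in *.
    rewrite norm_homogeneous, Rabs_pos_eq in HC by lra.
    pose proof (norm_nonneg x). apply Rmult_le_reg_l with t; [assumption |]. nra.
Qed.

Lemma orbit_observation_continuous (y : H) :
  continuous_on_halfline (fun t => S t y) ->
  forall t, continuous (fun s => inner (B (S (Rmax 0 s) y)) (S (Rmax 0 s) y)) t.
Proof.
  intros Hy t.
  apply (continuous_inner (fun s => B (S (Rmax 0 s) y)) (fun s => S (Rmax 0 s) y)).
  - apply (continuous_extension (fun s => B (S s y))).
    apply continuous_on_halfline_linear; assumption.
  - apply (continuous_extension (fun s => S s y)). assumption.
Qed.

Lemma orbit_observation_integrable (y : H) (T : R) :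
  0 < T -> ex_RInt (fun t => inner (B (S t y)) (S t y)) 0 T.
Proof.
  intros HT.
  apply (ex_RInt_ext (V := R_NormedModule)
    (fun s => inner (B (S (Rmax 0 s) y)) (S (Rmax 0 s) y))).
  - intros s Hs. rewrite Rmin_left, Rmax_right in Hs by lra.
    rewrite Rmax_right by lra. reflexivity.
  - apply (ex_RInt_continuous (V := R_CompleteNormedModule)). intros s _.
    apply orbit_observation_continuous, orbit_continuous; assumption.
Qed.

(* [e = u - S y] solves [e' = A e + c B e + c B S y], and completing the square
   gives [2 c <e, B e + B S y> <= - c / 2 <B S y, S y>]. *)
Lemma closed_loop_deviation (u : R -> H) (y : H) (T : R) :
  c <= 0 -> closed_loop u y -> 0 < T ->
  norm (minus (u T) (S T y)) ^ 2
    <= - c / 2 * RInt (fun t => inner (B (S t y)) (S t y)) 0 T.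
Proof.
  intros Hc [Cu Mu] HT.
  pose (e := fun t => plus (u t) (scal (-1) (S t y))).
  (* The zero forcing of the free orbit is kept as a summand so that the superposition lemmas match
     it syntactically. *)
  pose (f := fun t => plus (scal c (B (u t))) (scal (-1) (@zero H))).
  assert (Horb := orbit_continuous S HS Hiso y).
  assert (Ce : continuous_on_halfline e).
  { apply continuous_on_halfline_plus; [exact Cu |].
    apply (continuous_on_halfline_linear (fun x => scal (-1) x));
      [apply is_linear_homothety |].
    exact Horb. }
  assert (Me : mild S (fun t => scal c (B (u t))) e (plus y (scal (-1) y))).
  { apply mild_ext with f.
    - intros t _. unfold f.
      etransitivity; [| exact (plus_zero_r (G := H) (scal c (B (u t))))].
      f_equal. exact (@scal_zero_r R_Ring H (-1)).
    - apply mild_plus; [assumption | exact Mu |].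
      apply mild_scal; [assumption |]. apply mild_orbit. assumption. }
  pose proof (energy_identity S HS Hiso _ e _ (continuous_feedback u Cu)
    Ce Me T HT) as HI.
  assert (E0 : inner (plus y (scal (-1) y)) (plus y (scal (-1) y)) = 0).
  { rewrite inner_plus_l, inner_scal_l. ring. }
  rewrite E0, Rminus_0_r in HI.
  rewrite minus_scal. fold (e T).
  replace (norm (e T) ^ 2) with (inner (e T) (e T)) by (rewrite <- norm_mul_self; ring).
  apply (is_RInt_le _ (fun t => scal (- c / 2) (inner (B (S t y)) (S t y))) 0 T
    (inner (e T) (e T)) _ (Rlt_le _ _ HT) HI).
  - apply (is_RInt_scal (V := R_NormedModule)).
    apply (RInt_correct (V := R_CompleteNormedModule)).
    apply orbit_observation_integrable. assumption.
  - intros t _.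
    change (2 * inner (e t) (scal c (B (u t)))
      <= - c / 2 * inner (B (S t y)) (S t y)).
    pose (w := S t y). fold w.
    assert (Eu : u t = plus (e t) w).
    { unfold e. fold w. rewrite <- minus_scal, plus_comm. symmetry.
      exact (plus_minus_r (G := H) (u t) w). }
    rewrite inner_scal_r, Eu, <- (proj1 HBpos).
    rewrite inner_plus_r.
    (* The completed square: <B(e + w/2), e + w/2> = <B e, e> + <B e, w> + <B w, w> / 4, where
       self-adjointness merges the two cross terms. Multiplying by 2 c <= 0 gives the bound. *)
    pose proof (proj2 HBpos (plus (e t) (scal (/ 2) w))) as Hq.
    rewrite (proj1 HBpos), inner_plus_l, inner_scal_l, <- !(proj1 HBpos) in Hq.
    rewrite !inner_plus_r, !inner_scal_r in Hq.
    assert (Hs : inner (B w) (e t) = inner (B (e t)) w)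
      by (rewrite (proj1 HBpos); apply inner_sym).
    rewrite Hs in Hq. nra.
Qed.

End ClosedLoop.

(** * The observability inequality, according to the sign of the control *)

Theorem theorem12 (H : RealHilbert) (D : H -> Prop) (A : H -> H)
    (S0 : R -> H -> H) (B : H -> H)
    (hS : C0_semigroup S0) (hiso : isometric_family S0)
    (hA : generates D A S0)
    (hBlin : is_linear B) (hBpos : positive_operator B)
    (hstab : exp_stabilizable_const S0 B) :
  exists T delta : R, 0 < T /\ 0 < delta /\
    forall y : H,
      ex_RInt (fun t => inner (B (S0 t y)) (S0 t y)) 0 T /\
      RInt (fun t => inner (B (S0 t y)) (S0 t y)) 0 T >= delta * norm y ^ 2.
Proof.
  destruct hstab as [c hc].
  destruct (choice (fun z0 z => mild_solution S0 B c z0 z /\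
    exists M sigma : R, 0 < M /\ 0 < sigma /\
       forall t : R, 0 <= t -> norm (z t) <= M * exp (- sigma * t) * norm z0))
    as [Z HZ].
  { intros z0. destruct (hc z0) as [z [Hz [_ Hd]]]. exists z. split; assumption. }
  assert (Hcl : forall x, closed_loop S0 B c (Z x) x).
  { intros x. apply closed_loop_of_mild_solution; [assumption | apply HZ]. }
  destruct (Rlt_dec c 0) as [Hc | Hc].
  - destruct (uniform_contraction_time S0 B c hS hiso hBlin hBpos Z
      (Rlt_le _ _ Hc) Hcl (fun x => proj2 (HZ x))) as [T [HT HZT]].
    (* With k = - c, the estimate |y|^2 / 4 <= (k / 2) I reads I >= |y|^2 / (2 k). *)
    exists T, (/ (2 * - c)). split; [assumption |].
    split; [apply Rinv_0_lt_compat; lra |]. intros y.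
    split; [apply orbit_observation_integrable; assumption |].
    pose proof (closed_loop_deviation S0 B c hS hiso hBlin hBpos (Z y) y T
      (Rlt_le _ _ Hc) (Hcl y) HT) as Hdev.
    set (I := RInt _ 0 T) in *.
    assert (Hlow : norm y / 2 <= norm (minus (Z y T) (S0 T y))).
    { pose proof (norm_le_minus (S0 T y) (Z y T)) as E.
      rewrite (hiso T y) in E by lra. rewrite norm_minus_sym in E.
      specialize (HZT y). lra. }
    assert (Hsq : (norm y / 2) ^ 2 <= norm (minus (Z y T) (S0 T y)) ^ 2).
    { apply pow_incr. split; [| assumption]. pose proof (norm_nonneg y). lra. }
    apply Rle_ge. apply Rmult_le_reg_l with (2 * - c); [lra |].
    rewrite <- Rmult_assoc, Rinv_r by lra. lra.
  - assert (Hzero : forall y : H, norm y = 0).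
    { intros y. destruct (HZ y) as [_ [M [sigma [HM [Hsig Hd]]]]].
      apply NNPP. intros Hy. pose proof (norm_nonneg y).
      (* At this time the decay factor is M exp(-M) < 1, since exp(M) >= 1 + M, whereas the norm has
         not decreased. *)
      pose (t := M / sigma).
      assert (Ht : 0 < t) by (apply Rdiv_lt_0_compat; assumption).
      pose proof (closed_loop_nondecreasing S0 B c hS hiso hBlin hBpos (Z y) y t
        ltac:(lra) (Hcl y) Ht) as Hup.
      specialize (Hd t (Rlt_le _ _ Ht)).
      assert (HE : M * exp (- sigma * t) < 1).
      { replace (- sigma * t) with (- M) by (unfold t; field; lra).
        rewrite exp_Ropp. apply Rmult_lt_reg_r with (exp M); [apply exp_pos |].
        rewrite Rmult_assoc, Rinv_l by (pose proof (exp_pos M); lra).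
        pose proof (exp_ineq1_le M). lra. }
      assert (Hy' : 0 < norm y) by lra. nra. }
    (* All norms vanish, so any positive constants do; the integral is nonnegative by positivity of
       [B]. *)
    exists 1, 1. split; [lra |]. split; [lra |]. intros y.
    assert (Hex := orbit_observation_integrable S0 B hS hiso hBlin y 1 Rlt_0_1).
    split; [exact Hex |].
    rewrite Hzero. apply Rle_ge. replace (1 * 0 ^ 2) with 0 by ring.
    apply RInt_ge_0; [lra | exact Hex |]. intros t _. apply (proj2 hBpos).
Qed.
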